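(* Let $G_0=(G,* )$ be a noncommutative groupoid. Then: (a) $Iso(G',G_0)\subset \mathit{Half}_S(G_0)$ for every $G'\in\mathcal{M}_I(G_0)$. (b) For each $G'\in\mathcal{M}_I(G_0)$, $Iso(G',G_0)$ is a right coset of $Aut(G_0)$ in $\mathit{Half}_S(G_0)$, that is, there exists $f\in\mathit{Half}_S(G_0)$ such that $Iso(G',G_0)=Aut(G_0)f$. (c) For $G_1,G_2\in\mathcal{M}_I(G_0)$, if $Iso(G_1,G_0)\cap Iso(G_2,G_0)\neq\emptyset$, then $G_1=G_2$. (d) $\mathit{Half}_S(G_0)=\bigcup_{G'\in\mathcal{M}_I(G_0)}Iso(G',G_0)$. (e) $|\mathcal{M}_I(G_0)|=[\mathit{Half}_S(G_0):Aut(G_0)]$, the index of $Aut(G_0)$ in $\mathit{Half}_S(G_0)$.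
   Context: A groupoid is a nonempty set with a binary operation. For groupoids $(A,* )$ and $(B,\cdot)$, a bijection $f:A\to B$ is a half-isomorphism if $f(x*y)\in\{f(x)\cdot f(y),f(y)\cdot f(x)\}$ for all $x,y\in A$; it is special if $f^{-1}$ is also a half-isomorphism. $\mathit{Half}_S(G_0)$ is the set of special half-isomorphisms of $G_0$ onto itself (a group under composition), and $Aut(G_0)$ is the automorphism group of $G_0$. A principal h-groupoid of $G_0=(G,* )$ is a groupoid $(G,\cdot)$ on the same underlying set $G$ for which the identity mapping $G_0\to(G,\cdot)$ is a special half-isomorphism. $\mathcal{M}(G_0)$ is the set of principal h-groupoids of $G_0$; two elements $(G,\cdot),(G,\bullet)$ of it are equal iff $x\cdot y=x\bullet y$ for all $x,y\in G$. $\mathcal{M}_I(G_0)=\{G'\in\mathcal{M}(G_0)\mid G'\cong G_0\}$, where $\cong$ is isomorphism of groupoids. For $G'\in\mathcal{M}_I(G_0)$, $Iso(G',G_0)$ is the set of permutations $f$ of $G$ that are isomorphisms of $G'$ onto $G_0$. *)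

(* Defs.v *)
From mathcomp Require Import all_boot.
From mathcomp Require Import boolp classical_sets functions cardinality.

Set Implicit Arguments.
Unset Strict Implicit.
Unset Printing Implicit Defensive.

Local Open Scope classical_set_scope.

(* A groupoid (magma) with underlying set T is given by its operation
   T -> T -> T, since several operations on the same T are compared.  A
   noncommutative operation forces T to be nonempty.  By functional
   extensionality, equality of operations is pointwise equality. *)

Definition half_isomorphism (A B : Type) (opA : A -> A -> A)
    (opB : B -> B -> B) (f : A -> B) : Prop :=
  bijective f /\
  forall x y : A, f (opA x y) = opB (f x) (f y) \/ f (opA x y) = opB (f y) (f x).

Definition special_half_isomorphism (A B : Type) (opA : A -> A -> A)
    (opB : B -> B -> B) (f : A -> B) : Prop :=
  half_isomorphism opA opB f /\
  exists g : B -> A, [/\ cancel f g, cancel g f & half_isomorphism opB opA g].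

Definition isomorphism (A B : Type) (opA : A -> A -> A)
    (opB : B -> B -> B) (f : A -> B) : Prop :=
  bijective f /\ forall x y : A, f (opA x y) = opB (f x) (f y).

Definition isomorphic (A B : Type) (opA : A -> A -> A) (opB : B -> B -> B) : Prop :=
  exists f : A -> B, isomorphism opA opB f.

Section OneUnderlyingSet.
Variable T : Type.
Implicit Types op : T -> T -> T.

Definition HalfS op : set (T -> T) := [set f | special_half_isomorphism op op f].

Definition Iso op1 op2 : set (T -> T) := [set f | isomorphism op1 op2 f].

Definition Aut op : set (T -> T) := Iso op op.

(* The first argument is the operation of G_0. *)
Definition principal_h_groupoids op : set (T -> T -> T) :=
  [set op' | special_half_isomorphism op op' idfun].

Definition principal_h_groupoids_iso op : set (T -> T -> T) :=
  [set op' | principal_h_groupoids op op' /\ isomorphic op' op].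

(* Permutations compose from right to left: in H f, f is applied first. *)
Definition right_coset (H : set (T -> T)) (f : T -> T) : set (T -> T) :=
  [set h \o f | h in H].

(* The index of H in K is the cardinality of this set. *)
Definition right_cosets (H K : set (T -> T)) : set (set (T -> T)) :=
  [set right_coset H f | f in K].

End OneUnderlyingSet.

(* Main.v *)
(* For [f] in Half_S(G_0), transporting the operation of G_0 along [f^-1] gives
   the only groupoid on G from which [f] is an isomorphism onto G_0, and it is a
   principal h-groupoid.  So G' |-> Iso(G', G_0) is injective, and its values are
   exactly the right cosets of Aut(G_0) in Half_S(G_0). *)

Require Import Defs.
From mathcomp Require Import all_boot.
From mathcomp Require Import boolp classical_sets functions cardinality.

Local Open Scope classical_set_scope.
Local Open Scope card_scope.

Section Isomorphisms.
Set Implicit Arguments.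
Unset Strict Implicit.

Variables A B C : Type.
Implicit Types (opA : A -> A -> A) (opB : B -> B -> B) (opC : C -> C -> C).

Lemma isomorphism_comp opA opB opC (f : A -> B) (h : B -> C) :
  isomorphism opA opB f -> isomorphism opB opC h -> isomorphism opA opC (h \o f).
Proof.
move=> [fbij fM] [hbij hM]; split; first exact: bij_comp.
by move=> x y /=; rewrite fM hM.
Qed.

Lemma isomorphism_inv opA opB (f : A -> B) (g : B -> A) :
  cancel f g -> cancel g f -> isomorphism opA opB f -> isomorphism opB opA g.
Proof.
move=> fK gK [_ fM]; split; first by exists f.
by move=> x y; rewrite -{1}(gK x) -{1}(gK y) -fM fK.
Qed.

Lemma isomorphism_special_half opA opB (f : A -> B) :
  isomorphism opA opB f -> special_half_isomorphism opA opB f.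
Proof.
move=> fiso; have [[g fK gK] fM] := fiso.
have [gbij gM] := isomorphism_inv fK gK fiso.
split; first by split=> [|x y]; [exists g | left].
by exists g; split=> //; split=> // x y; left.
Qed.

(** Each map either keeps or swaps the two factors of a product, and two swaps cancel. *)
Lemma half_isomorphism_comp opA opB opC (f : A -> B) (h : B -> C) :
  half_isomorphism opA opB f -> half_isomorphism opB opC h ->
  half_isomorphism opA opC (h \o f).
Proof.
move=> [fbij fM] [hbij hM]; split; first exact: bij_comp.
move=> x y /=; case: (fM x y) => ->; first exact: hM.
by case: (hM (f y) (f x)) => ->; [right | left].
Qed.

End Isomorphisms.

Lemma special_half_isomorphism_comp (A B C : Type) (opA : A -> A -> A)
    (opB : B -> B -> B) (opC : C -> C -> C) (f : A -> B) (h : B -> C) :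
  special_half_isomorphism opA opB f -> special_half_isomorphism opB opC h ->
  special_half_isomorphism opA opC (h \o f).
Proof.
move=> [fhalf [f' [fK f'K f'half]]] [hhalf [h' [hK h'K h'half]]].
split; first exact: half_isomorphism_comp fhalf hhalf.
exists (f' \o h'); split; first exact: can_comp.
  exact: can_comp.
exact: half_isomorphism_comp h'half f'half.
Qed.
Arguments special_half_isomorphism_comp {A B C opA opB opC f h}.

Section PrincipalGroupoids.
Set Implicit Arguments.
Unset Strict Implicit.

Variables (G : Type) (op0 : G -> G -> G).
Implicit Types (op : G -> G -> G) (f : G -> G).

(** As a map from [op0] to [op0], [f] is the identity from [op0] to [op], special by hypothesis,
    followed by the isomorphism [f] from [op] to [op0]. *)
Lemma Iso_sub_HalfS op :
  principal_h_groupoids op0 op -> Iso op op0 `<=` HalfS op0.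
Proof.
move=> op0op f /isomorphism_special_half fspec.
exact: special_half_isomorphism_comp op0op fspec.
Qed.

(** Two isomorphisms [f] and [h] from [op] to [op0] differ by the automorphism [h \o g] of [op0],
    where [g] inverts [f]; hence any isomorphism can serve as representative. *)
Lemma Iso_right_coset op f :
  Iso op op0 f -> Iso op op0 = right_coset (Aut op0) f.
Proof.
move=> fiso; have [[g fK gK] _] := fiso.
apply/seteqP; split=> [h hiso | _ [a aiso <-]]; last first.
  exact: isomorphism_comp fiso aiso.
exists (h \o g); last by apply/funext => x /=; rewrite fK.
exact: isomorphism_comp (isomorphism_inv fK gK fiso) hiso.
Qed.

(** The map [f] determines the operation: the product of [x] and [y] must be the preimage under [f]
    of [op0 (f x) (f y)]. *)
Lemma Iso_inj op1 op2 f : Iso op1 op0 f -> Iso op2 op0 f -> op1 = op2.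
Proof.
move=> [fbij f1] [_ f2]; apply/funext => x; apply/funext => y.
by apply: (bij_inj fbij); rewrite f1 f2.
Qed.

Lemma HalfS_Iso f :
  HalfS op0 f -> exists2 op, principal_h_groupoids_iso op0 op & Iso op op0 f.
Proof.
move=> fspec; have [_ [g [fK gK _]]] := fspec.
pose op x y := g (op0 (f x) (f y)).
have fiso : isomorphism op op0 f by split=> [|x y]; [exists g | rewrite /op gK].
have giso := isomorphism_inv fK gK fiso.
exists op => //; split; last by exists f.
(* The identity from [op0] to [op] factors as [f] from [op0] to itself followed by the isomorphism
   [g] from [op0] to [op], so it is special. *)
have := special_half_isomorphism_comp
  fspec (isomorphism_special_half giso).
by rewrite /principal_h_groupoids/= (_ : g \o f = idfun)//; apply/funext.
Qed.

(** This reduces the index in (e) to the cardinality of the image of [op |-> Iso op op0], leaving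
    only injectivity to check. *)
Lemma right_cosets_Iso :
  right_cosets (Aut op0) (HalfS op0) =
  [set Iso op op0 | op in principal_h_groupoids_iso op0].
Proof.
apply/seteqP; split=> [_ [f fspec <-] | _ [op [opP [f fiso]] <-]].
  have [op opP fiso] := HalfS_Iso fspec.
  by exists op => //; exact: Iso_right_coset.
by exists f; [exact: Iso_sub_HalfS opP _ fiso | rewrite (Iso_right_coset fiso)].
Qed.

End PrincipalGroupoids.

Theorem proposition4p3 (G : Type) (op0 : G -> G -> G)
    (op0_noncomm : ~ commutative op0) :
  [/\ (* (a) *)
      forall op' : G -> G -> G, principal_h_groupoids_iso op0 op' ->
        Iso op' op0 `<=` HalfS op0,
      (* (b) *)
      forall op' : G -> G -> G, principal_h_groupoids_iso op0 op' ->
        exists f : G -> G, HalfS op0 f /\ Iso op' op0 = right_coset (Aut op0) f,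
      (* (c) *)
      forall op1 op2 : G -> G -> G,
        principal_h_groupoids_iso op0 op1 -> principal_h_groupoids_iso op0 op2 ->
        Iso op1 op0 `&` Iso op2 op0 !=set0 -> op1 = op2,
      (* (d) *)
      HalfS op0 = \bigcup_(op' in principal_h_groupoids_iso op0) Iso op' op0 &
      (* (e) *)
      principal_h_groupoids_iso op0 #= right_cosets (Aut op0) (HalfS op0)].
Proof.
split.
- by move=> op' [op'P _]; exact: Iso_sub_HalfS.
- move=> op' [op'P [f fiso]]; exists f.
  split; first exact: Iso_sub_HalfS op'P _ fiso.
  exact: Iso_right_coset.
- by move=> op1 op2 _ _ [f [f1 f2]]; exact: Iso_inj f1 f2.
- apply/seteqP; split=> [f /HalfS_Iso [op' op'P fiso] | f [op' [op'P _]]].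
    by exists op'.
  exact: Iso_sub_HalfS.
- rewrite right_cosets_Iso card_eq_sym; apply: inj_card_eq.
  (* Since [op1] is isomorphic to [op0], the common value of the two [Iso] sets is nonempty, and any
     [f] in it forces the operations to agree. *)
  move=> op1 op2 /set_mem [_ [f f1]] _ eq12.
  have f2 : Iso op2 op0 f by rewrite -eq12.
  exact: Iso_inj f1 f2.
Qed.
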